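(* Let $>$ be a reduction order and let $\Gamma\colon(\mathcal{E}_0,\mathcal{R}_0)\vdash_{\mathsf l}(\mathcal{E}_1,\mathcal{R}_1)\vdash_{\mathsf l}(\mathcal{E}_2,\mathcal{R}_2)\vdash_{\mathsf l}\cdots$ be an infinite run of linear ordered completion $\mathsf{KB_l}$ with respect to $>$, with $\mathcal{R}_0=\varnothing$ and $\mathcal{E}_0$ linear. If $\Gamma$ is fair and $\mathcal{E}_\omega=\varnothing$ then $\mathcal{R}_\omega$ is a complete presentation of $\mathcal{E}_0$.
   Context: Terms are built from a signature $\mathcal{F}$ and an infinite set of variables. An ES is a set of pairs of terms $s\approx t$; a TRS is a set of pairs $\ell\to r$ with $\ell$ not a variable and every variable of $r$ occurring in $\ell$. An equation or rule is linear if no variable occurs more than once in its left-hand side and no variable occurs more than once in its right-hand side; a set is linear if all its elements are. For a set $X$ of pairs of terms, $X^{\pm}=X\cup X^{-1}$, $\to_X$ is the closure of $X$ under contexts and substitutions, $\leftrightarrow_X$ its symmetric closure, $\leftrightarrow_X^*$ the conversion relation, and $\downarrow_X\,=\,\to_X^*\cdot{}_X^*{\leftarrow}$ joinability. A reduction order is a well-founded strict order on terms closed under contexts and substitutions. A TRS is complete if it is terminating and confluent; $\mathcal{R}$ is a complete presentation of $\mathcal{E}$ if $\mathcal{R}$ is complete and $\leftrightarrow_{\mathcal{R}}^*\,=\,\leftrightarrow_{\mathcal{E}}^*$. A term $s$ encompasses $t$ if $s=C[t\sigma]$ for some $C,\sigma$; properly, if moreover $t$ does not encompass $s$. Inference system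 $\mathsf{KB_l}$ ($\uplus$ is disjoint union): $(\mathcal{E},\mathcal{R})\vdash_{\mathsf l}(\mathcal{E}',\mathcal{R}')$ if it is an instance of one of - deduce: $(\mathcal{E},\mathcal{R})\vdash(\mathcal{E}\cup\{s\approx t\},\mathcal{R})$ if $s\,{}_{\mathcal{E}^\pm\cup\mathcal{R}}{\leftarrow}\cdot\to_{\mathcal{E}^\pm\cup\mathcal{R}}t$ and $s\approx t$ is linear; - orient: $(\mathcal{E}\uplus\{s\approx t\},\mathcal{R})\vdash(\mathcal{E},\mathcal{R}\cup\{s\to t\})$ if $s>t$, and $(\mathcal{E}\uplus\{s\approx t\},\mathcal{R})\vdash(\mathcal{E},\mathcal{R}\cup\{t\to s\})$ if $t>s$; - delete: $(\mathcal{E}\uplus\{s\approx s\},\mathcal{R})\vdash(\mathcal{E},\mathcal{R})$; - compose: $(\mathcal{E},\mathcal{R}\uplus\{s\to t\})\vdash(\mathcal{E},\mathcal{R}\cup\{s\to u\})$ if $t\to_{\mathcal{R}}u$; - simplify: $(\mathcal{E}\uplus\{s\approx t\},\mathcal{R})\vdash(\mathcal{E}\cup\{u\approx t\},\mathcal{R})$ if $s\to_{\mathcal{R}}u$, and $(\mathcal{E}\uplus\{s\approx t\},\mathcal{R})\vdash(\mathcal{E}\cup\{s\approx u\},\mathcal{R})$ if $t\to_{\mathcal{R}}u$; - collapse: $(\mathcal{E},\mathcal{R}\uplus\{t\to s\})\vdash(\mathcal{E}\cup\{u\approx s\},\mathcal{R})$ if $t\to u$ using some rule $\ell\to r\in\mathcal{R}$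 such that $t$ properly encompasses $\ell$. For an infinite run put $\mathcal{E}_\infty=\bigcup_{i}\mathcal{E}_i$, $\mathcal{E}_\omega=\bigcup_{i}\bigcap_{j\ge i}\mathcal{E}_j$, $\mathcal{R}_\omega=\bigcup_{i}\bigcap_{j\ge i}\mathcal{R}_j$. Linear critical pairs: an extended overlap of an ES $\mathcal{E}$ is a triple $\langle\ell_1\approx r_1,p,\ell_2\approx r_2\rangle$ where both equations are variants (up to renaming) of equations in $\mathcal{E}^\pm$ without common variables, $p$ is a non-variable position of $\ell_2$, $\ell_1$ and $\ell_2|_p$ are unifiable with mgu $\mu$, $r_1\mu\not>\ell_1\mu$ and $r_2\mu\not>\ell_2\mu$; it gives the extended critical pair $\ell_2[r_1]_p\mu\approx r_2\mu$. If moreover ($\ell_1>r_1$ and $r_2\not>\ell_2$) or ($\ell_2>r_2$ and $r_1\not>\ell_1$), this is a linear critical pair. $\mathrm{LCP}_>(\mathcal{E})$ is the set of linear critical pairs of $\mathcal{E}$ (rules are viewed as equations in $\mathcal{E}_\omega\cup\mathcal{R}_\omega$). The run is fair if $\mathrm{LCP}_>(\mathcal{E}_\omega\cup\mathcal{R}_\omega)\subseteq{\downarrow_{\mathcal{R}_\omega}}\cup{\leftrightarrow_{\mathcal{E}_\infty}}$. *)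

(* Defs.v *)
From Stdlib Require Export Relations.
From mathcomp Require Export all_boot.
From mathcomp Require Export boolp classical_sets functions cardinality.

Set Implicit Arguments.
Unset Strict Implicit.
Unset Printing Implicit Defensive.

Local Open Scope classical_set_scope.

Section Terms.

(* [ar] gives the arity of each symbol of the signature [F]. *)
Variables (F : Type) (ar : F -> nat) (V : eqType).

Inductive term : Type :=
| Var of V
| App (f : F) of {ffun 'I_(ar f) -> term}.

Fixpoint subst (sigma : V -> term) (t : term) : term :=
  match t with
  | Var x => sigma x
  | App f ts => App [ffun i => subst sigma (ts i)]
  end.

(* The variable occurrences of a term, from left to right, with repetitions. *)
Fixpoint vars (t : term) : seq V :=
  match t with
  | Var x => [:: x]
  | App f ts => flatten [seq vars (ts i) | i <- enum 'I_(ar f)]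
  end.

Definition is_var (t : term) : bool := if t is Var _ then true else false.

(* The [i]-th argument of the list [ts] stored in a context is irrelevant:
   that place is taken by the subcontext. *)
Inductive ctx : Type :=
| Hole
| CApp (f : F) (i : 'I_(ar f)) of {ffun 'I_(ar f) -> term} & ctx.

Fixpoint fill (C : ctx) (t : term) : term :=
  match C with
  | Hole => t
  | CApp f i ts C' =>
      App [ffun j => if j == i then fill C' t else ts j]
  end.

(* Positions are sequences of argument indices, counted from 0;
   [subterm_at t p] is [None] if [p] is not a position of [t]. *)
Fixpoint subterm_at (t : term) (p : seq nat) : option term :=
  match p, t with
  | [::], _ => Some t
  | i :: q, App f ts =>
      if insub i is Some j then subterm_at (ts j) q else None
  | _ :: _, Var _ => None
  end.

Fixpoint replace_at (t : term) (p : seq nat) (u : term) : term :=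
  match p, t with
  | [::], _ => u
  | i :: q, App f ts =>
      App [ffun j => if val j == i then replace_at (ts j) q u else ts j]
  | _ :: _, Var _ => t
  end.

(* Equations and rules are ordered pairs of terms. *)
Definition eqn : Type := (term * term)%type.

Definition is_trs (R : set eqn) : Prop :=
  forall l r, R (l, r) -> ~~ is_var l /\ {subset vars r <= vars l}.

Definition linear_eqn (e : eqn) : Prop := uniq (vars e.1) /\ uniq (vars e.2).

Definition linear_set (X : set eqn) : Prop := forall e, X e -> linear_eqn e.

Definition pm (X : set eqn) : set eqn := X `|` [set (e.2, e.1) | e in X].

Definition rstep (X : set eqn) : relation term := fun s t =>
  exists C l r sigma,
    [/\ X (l, r), s = fill C (subst sigma l) & t = fill C (subst sigma r)].

Definition estep (X : set eqn) : relation term := fun s t =>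
  rstep X s t \/ rstep X t s.

Definition rsteps (X : set eqn) : relation term := clos_refl_trans _ (rstep X).

Definition conv (X : set eqn) : relation term := clos_refl_trans _ (estep X).

Definition joinable (X : set eqn) : relation term := fun s t =>
  exists2 u, rsteps X s u & rsteps X t u.

Definition terminating (R : set eqn) : Prop :=
  well_founded (fun t s => rstep R s t).

Definition confluent (R : set eqn) : Prop :=
  forall s t u, rsteps R s t -> rsteps R s u -> joinable R t u.

Definition complete_trs (R : set eqn) : Prop :=
  [/\ is_trs R, terminating R & confluent R].

Definition complete_presentation (R E : set eqn) : Prop :=
  complete_trs R /\ (forall s t, conv R s t <-> conv E s t).

(* [gt s t] stands for s > t. *)
Record reduction_order (gt : relation term) : Prop := {
  ro_irrefl : forall s, ~ gt s s;
  ro_trans : forall s t u, gt s t -> gt t u -> gt s u;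
  ro_wf : well_founded (fun t s => gt s t);
  ro_ctx : forall C s t, gt s t -> gt (fill C s) (fill C t);
  ro_subst : forall sigma s t, gt s t -> gt (subst sigma s) (subst sigma t)
}.

Definition encompasses (s t : term) : Prop :=
  exists C sigma, s = fill C (subst sigma t).

Definition properly_encompasses (s t : term) : Prop :=
  encompasses s t /\ ~ encompasses t s.

(* The disjoint unions in the premises of the rules are expressed by the
   hypotheses [~ E _] and [~ R _]. *)
Inductive kbl (gt : relation term) :
    set eqn * set eqn -> set eqn * set eqn -> Prop :=
| kbl_deduce E R s t u :
    rstep (pm E `|` R) u s -> rstep (pm E `|` R) u t -> linear_eqn (s, t) ->
    kbl gt (E, R) (E `|` [set (s, t)], R)
| kbl_orient_lr E R s t :
    ~ E (s, t) -> gt s t ->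
    kbl gt (E `|` [set (s, t)], R) (E, R `|` [set (s, t)])
| kbl_orient_rl E R s t :
    ~ E (s, t) -> gt t s ->
    kbl gt (E `|` [set (s, t)], R) (E, R `|` [set (t, s)])
| kbl_delete E R s :
    ~ E (s, s) ->
    kbl gt (E `|` [set (s, s)], R) (E, R)
| kbl_compose E R s t u :
    ~ R (s, t) -> rstep R t u ->
    kbl gt (E, R `|` [set (s, t)]) (E, R `|` [set (s, u)])
| kbl_simplify_l E R s t u :
    ~ E (s, t) -> rstep R s u ->
    kbl gt (E `|` [set (s, t)], R) (E `|` [set (u, t)], R)
| kbl_simplify_r E R s t u :
    ~ E (s, t) -> rstep R t u ->
    kbl gt (E `|` [set (s, t)], R) (E `|` [set (s, u)], R)
| kbl_collapse E R t s u l r :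
    ~ R (t, s) -> R (l, r) -> rstep [set (l, r)] t u ->
    properly_encompasses t l ->
    kbl gt (E, R `|` [set (t, s)]) (E `|` [set (u, s)], R).

Definition union_set (X : nat -> set eqn) : set eqn := \bigcup_i X i.

Definition persistent (X : nat -> set eqn) : set eqn :=
  \bigcup_i \bigcap_(j >= i) X j.

Definition rename (rho : V -> V) (t : term) : term := subst (Var \o rho) t.

Definition variant_of (e e' : eqn) : Prop :=
  exists2 rho : V -> V,
    bijective rho & e = (rename rho e'.1, rename rho e'.2).

Definition unifier (mu : V -> term) (s t : term) : Prop :=
  subst mu s = subst mu t.

Definition mgu (mu : V -> term) (s t : term) : Prop :=
  unifier mu s t /\
  forall tau, unifier tau s t -> exists delta, tau =1 subst delta \o mu.

Definition disjoint_vars (e e' : eqn) : Prop :=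
  ~~ has (mem (vars e.1 ++ vars e.2)) (vars e'.1 ++ vars e'.2).

(* The overlap <l1 = r1, p, l2 = r2> with most general unifier [mu]. *)
Record extended_overlap (gt : relation term) (E : set eqn)
    (l1 r1 : term) (p : seq nat) (l2 r2 : term) (mu : V -> term) : Prop := {
  eo_variant1 : exists2 e, pm E e & variant_of (l1, r1) e;
  eo_variant2 : exists2 e, pm E e & variant_of (l2, r2) e;
  eo_disjoint : disjoint_vars (l1, r1) (l2, r2);
  eo_mgu : exists u, [/\ subterm_at l2 p = Some u, ~~ is_var u & mgu mu l1 u];
  eo_ngt1 : ~ gt (subst mu r1) (subst mu l1);
  eo_ngt2 : ~ gt (subst mu r2) (subst mu l2)
}.

Definition LCP (gt : relation term) (E : set eqn) : set eqn :=
  [set e | exists l1 r1 p l2 r2 mu,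
    [/\ extended_overlap gt E l1 r1 p l2 r2 mu,
        (gt l1 r1 /\ ~ gt r2 l2) \/ (gt l2 r2 /\ ~ gt r1 l1) &
        e = (subst mu (replace_at l2 p r1), subst mu r2)]].

Definition infinite_run (gt : relation term) (E R : nat -> set eqn) : Prop :=
  forall i, kbl gt (E i, R i) (E i.+1, R i.+1).

Definition fair (gt : relation term) (E R : nat -> set eqn) : Prop :=
  forall s t, LCP gt (persistent E `|` persistent R) (s, t) ->
    joinable (persistent R) s t \/ estep (union_set E) s t.

End Terms.

(* Main.v *)
(* Every rule l -> r that ever occurs converts by persistent rules through terms
   bounded by l, and every equation s = t that ever occurs through terms bounded
   by s or by t: since no equation persists, each of these is eventually replaced
   by one inference, and the replacements are smaller. Hence critical pairs of
   persistent rules, which by fairness are joinable or are occurring equations,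
   are connected below the source of their peak. The rules decrease in a
   well-founded order, so connectedness below all peaks gives confluence. *)
Require Import Defs.
From mathcomp Require Import zify.

Set Implicit Arguments.
Unset Strict Implicit.
Unset Printing Implicit Defensive.

Local Open Scope classical_set_scope.

(** Bounds refer to the two ends of a rule or equation because fairness turns a critical pair into
    one step of an occurring equation, whose ends both lie strictly below the source of the peak. A
    bound by the ends survives contexts and substitutions, so the whole replacing conversion stays
    below that source. The obstacle is collapse. The rule used on [l] may act at the root of [l],
    and a reduction order need not contain the subterm relation, so its left-hand side need not be
    smaller than [l] in [gt]. Only proper encompassment decreases there. Since persistent rules are
    strictly oriented, the order conditions on overlaps hold automatically for them, and their
    linear critical pairs cover all proper overlaps that occur in a peak. *)

Section TermFacts.

Variables (F : Type) (ar : F -> nat) (V : eqType).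

Local Notation term := (term ar V).
Local Notation ctx := (ctx ar V).
Local Notation eqn := (eqn ar V).
Local Notation Var := (@Var F ar V).
Local Notation Hole := (@Hole F ar V).

(** * Terms, substitutions, contexts and proper encompassment *)

Fixpoint term_ind_args (P : term -> Prop) (HV : forall x, P (Var x))
    (HA : forall f (ts : {ffun 'I_(ar f) -> term}),
      (forall i, P (ts i)) -> P (App ts)) (t : term) : P t :=
  match t with
  | Defs.Var x => HV x
  | App f ts => HA f ts (fun i => term_ind_args HV HA (ts i))
  end.

Lemma subterm_at_nil (t : term) : subterm_at t [::] = Some t.
Proof. by case: t. Qed.

Lemma replace_at_nil (t u : term) : replace_at t [::] u = u.
Proof. by case: t. Qed.

(** The argument tuple has a type depending on [f], and equality on [F] is not assumed decidable.
    Reading off one argument at a time through [subterm_at], whose result type is fixed, avoids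
    equalities of dependent pairs. *)
Lemma App_inj f (ts us : {ffun 'I_(ar f) -> term}) : App ts = App us -> ts = us.
Proof.
move=> e; apply/ffunP => i.
have := congr1 (fun t => subterm_at t [:: val i]) e.
by rewrite /= !valK !subterm_at_nil => -[].
Qed.

Lemma App_head f g (ts : {ffun 'I_(ar f) -> term}) (us : {ffun 'I_(ar g) -> term}) :
  App ts = App us -> f = g.
Proof. by case. Qed.

Lemma vars_AppP f (ts : {ffun 'I_(ar f) -> term}) x :
  reflect (exists i, x \in vars (ts i)) (x \in vars (App ts)).
Proof.
apply: (iffP flatten_mapP) => [[i _]|[i]]; first by exists i.
by exists i; rewrite ?mem_enum.
Qed.

Lemma eq_in_subst sigma tau (t : term) :
  {in vars t, sigma =1 tau} -> subst sigma t = subst tau t.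
Proof.
elim/term_ind_args: t => [x|f ts IH] /= st; first by apply: st; rewrite inE.
congr App; apply/ffunP => i; rewrite !ffunE; apply: IH => x xt.
by apply: st; apply/vars_AppP; exists i.
Qed.

Lemma eq_subst sigma tau (t : term) : sigma =1 tau -> subst sigma t = subst tau t.
Proof. by move=> st; apply: eq_in_subst => x _. Qed.

Lemma subst_Var (t : term) : subst Var t = t.
Proof.
elim/term_ind_args: t => [//|f ts IH] /=.
by congr App; apply/ffunP => i; rewrite ffunE IH.
Qed.

Lemma subst_comp sigma tau (t : term) :
  subst sigma (subst tau t) = subst (subst sigma \o tau) t.
Proof.
elim/term_ind_args: t => [//|f ts IH] /=.
by congr App; apply/ffunP => i; rewrite !ffunE IH.
Qed.

Lemma mem_vars_subst sigma (t : term) y :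
  reflect (exists2 x, x \in vars t & y \in vars (sigma x))
    (y \in vars (subst sigma t)).
Proof.
apply: (iffP idP).
  elim/term_ind_args: t => [x|f ts IH]; first by exists x; rewrite ?inE.
  case/vars_AppP => i; rewrite ffunE => /IH[x xt yx].
  by exists x => //; apply/vars_AppP; exists i.
case=> x + yx; elim/term_ind_args: t => [z|f ts IH].
  by rewrite /= inE => /eqP <-.
by case/vars_AppP => i /IH yi; apply/vars_AppP; exists i; rewrite ffunE.
Qed.

Lemma mem_vars_rename rho (t : term) y :
  reflect (exists2 x, x \in vars t & y = rho x) (y \in vars (rename rho t)).
Proof.
apply: (iffP (mem_vars_subst _ _ _)) => -[x xt] /=.
  by rewrite inE => /eqP; exists x.
by exists x => //=; rewrite inE; apply/eqP.
Qed.

Lemma vars_rename rho (t : term) : vars (rename rho t) = map rho (vars t).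
Proof.
elim/term_ind_args: t => [//|f ts IH] /=.
rewrite map_flatten -map_comp; congr flatten.
by apply: eq_map => i; rewrite ffunE /= IH.
Qed.

Fixpoint ctx_comp (C D : ctx) : ctx :=
  match C with
  | Defs.Hole => D
  | CApp f i ts C' => CApp i ts (ctx_comp C' D)
  end.

Lemma fill_comp C D t : fill (ctx_comp C D) t = fill C (fill D t).
Proof.
elim: C => [//|f i ts C IH] /=.
by congr App; apply/ffunP => j; rewrite !ffunE IH.
Qed.

Fixpoint ctx_subst (sigma : V -> term) (C : ctx) : ctx :=
  match C with
  | Defs.Hole => Hole
  | CApp f i ts C' =>
      CApp i [ffun j => subst sigma (ts j)] (ctx_subst sigma C')
  end.

Lemma subst_fill sigma C t :
  subst sigma (fill C t) = fill (ctx_subst sigma C) (subst sigma t).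
Proof.
elim: C => [//|f i ts C IH] /=.
congr App; apply/ffunP => j; rewrite !ffunE.
by case: eqP => _; rewrite ?IH.
Qed.

(* Weight 2 for function symbols makes a constant heavier than a variable, so
   that a substitution preserving the size of a term is a renaming on it. *)
Fixpoint term_size (t : term) : nat :=
  match t with
  | Defs.Var _ => 1
  | App f ts => (\sum_(i < ar f) term_size (ts i)).+2
  end.

Lemma term_size_gt0 t : 0 < term_size t.
Proof. by case: t. Qed.

Lemma term_size_arg f (ts : {ffun 'I_(ar f) -> term}) i :
  term_size (ts i) < term_size (App ts).
Proof. by rewrite /= ltnS (bigD1 i) //= leqW ?leq_addr. Qed.

Lemma term_size_fill C t : C = Hole \/ term_size t < term_size (fill C t).
Proof.
elim: C => [|f i ts C IH]; [by left|right].
have := term_size_arg [ffun j => if j == i then fill C t else ts j] i.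
rewrite ffunE eqxx; apply: leq_ltn_trans.
by case: IH => [->//|/ltnW].
Qed.

Lemma term_size_subst sigma t : term_size t <= term_size (subst sigma t).
Proof.
elim/term_ind_args: t => [x|f ts IH] /=; first exact: term_size_gt0.
by rewrite !ltnS; apply: leq_sum => i _; rewrite ffunE.
Qed.

Lemma term_size_subst_eq sigma t : term_size (subst sigma t) = term_size t ->
  {in vars t, forall x, is_var (sigma x)}.
Proof.
elim/term_ind_args: t => [x|f ts IH].
  by move=> /= sz y; rewrite inE => /eqP ->; case: (sigma x) sz.
move=> /= [] sz x /vars_AppP[i xi]; apply: (IH i) => //.
have le j : term_size (ts j) <= term_size ([ffun i => subst sigma (ts i)] j).
  by rewrite ffunE term_size_subst.
(* No summand shrinks under [sigma], so equal sums force equality in every argument. *)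
have /eq_leqif := leqif_sum (fun j (_ : true) => leqif_eq (le j)).
rewrite sz eqxx => /esym /forallP /(_ i) /eqP ->.
by rewrite ffunE.
Qed.

Definition nvars (t : term) : nat := size (undup (vars t)).

Lemma uniq_map_undup (rho : V -> V) s :
  size (undup s) <= size (undup (map rho s)) -> uniq (map rho (undup s)).
Proof.
move=> le; apply: (leq_size_uniq (undup_uniq (map rho s))).
  move=> y; rewrite mem_undup => /mapP[x xs ->].
  by apply/mapP; exists x; rewrite ?mem_undup.
by rewrite size_map.
Qed.

(** If the sizes agree, the context is empty and [sigma] maps the variables of [t] to variables.
    Were it injective on them, it could be inverted and [t] would encompass [s]; hence it identifies
    two variables and lowers their number. *)
Lemma proper_encompassment_measure s t : properly_encompasses s t ->
  term_size t < term_size s \/ term_size t = term_size s /\ nvars s < nvars t.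
Proof.
move=> [[C [sigma ->]] nts].
case: (term_size_fill C (subst sigma t)) => [eC|lt]; last first.
  by left; apply: leq_ltn_trans lt; exact: term_size_subst.
rewrite eC /= in nts *.
have := term_size_subst sigma t; rewrite leq_eqVlt => /orP[/eqP sz|]; last by left.
right; split=> //; rewrite ltnNge; apply/negP => le; apply: nts.
have svar := term_size_subst_eq (esym sz).
pose rho x := if sigma x is Defs.Var y then y else x.
have st : subst sigma t = rename rho t.
  apply: eq_in_subst => x /svar /=.
  by rewrite /rho; case: (sigma x).
move: le; rewrite st /nvars vars_rename => le.
have un := uniq_map_undup le.
(* The inverse renaming: [rho x] is sent back to the variable at the same index in the list of
   distinct variables of [t]. *)
exists Hole, (fun y => Var (nth y (undup (vars t))
  (index y (map rho (undup (vars t)))))) => /=.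
rewrite /rename subst_comp -{1}(subst_Var t).
apply: eq_in_subst => x xt /=; congr Var.
rewrite -mem_undup in xt.
have e : nth (rho x) (map rho (undup (vars t))) (index x (undup (vars t))) = rho x.
  by rewrite (nth_map x) ?index_mem // nth_index.
by rewrite -{2}e index_uniq ?size_map ?index_mem // nth_index.
Qed.

(** At constant size the number of variables grows downwards, but it is bounded by the size, so the
    pair of the size and the difference [term_size s - nvars s] decreases lexicographically. *)
Lemma wf_properly_encompasses :
  well_founded (fun t s : term => properly_encompasses s t).
Proof.
suff H n : forall s, term_size s < n -> Acc (fun t s : term => properly_encompasses s t) s.
  by move=> s; apply: (H (term_size s).+1).
elim: n => [//|n IHn] s0 szs0.
have : term_size s0 - nvars s0 < (term_size s0 - nvars s0).+1 by [].
move: {2}(_.+1) => k.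
elim: k s0 szs0 => [//|k IHk] s szs sk; constructor => t st.
case: (proper_encompassment_measure st) => [lt|[e lt]].
  by apply: IHn; apply: leq_trans lt _.
apply: IHk; first by rewrite e.
have le_t : nvars t <= term_size t.
  apply: leq_trans (size_undup _) _.
  elim/term_ind_args: (t) => [//|f ts IH] /=.
  rewrite size_flatten /shape -map_comp sumnE big_map big_enum /=.
  by do 2!apply: leqW; apply: leq_sum => i _; apply: IH.
rewrite e in le_t *; lia.
Qed.

(** * Existence of most general unifiers *)

Definition upd (sigma : V -> term) x t : V -> term :=
  fun y => if y == x then t else sigma y.

Lemma subst_upd_notin sigma x t u :
  x \notin vars u -> subst (upd sigma x t) u = subst sigma u.
Proof.
move=> xu; apply: eq_in_subst => y yu; rewrite /upd; case: eqP => // e.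
by rewrite -e yu in xu.
Qed.

Lemma term_size_occurs tau x t :
  x \in vars t -> term_size (tau x) <= term_size (subst tau t).
Proof.
elim/term_ind_args: t => [y|f ts IH] /=; first by rewrite inE => /eqP ->.
case/vars_AppP => i /IH; have := term_size_arg [ffun i => subst tau (ts i)] i.
by rewrite ffunE /= => lt le; apply: leq_trans le (ltnW lt).
Qed.

(** If [x] lay strictly inside [t], then [tau x] would be a proper subterm of itself, against its
    size. *)
Lemma occurs_check tau x t :
  x \in vars t -> tau x = subst tau t -> t = Var x.
Proof.
case: t => [y|f ts]; first by rewrite /= inE => /eqP ->.
case/vars_AppP => i /(term_size_occurs tau) le e.
have := term_size_arg [ffun i => subst tau (ts i)] i.
by rewrite ffunE -[App _]/(subst tau (App ts)) -e ltnNge le.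
Qed.

Definition unifies (tau : V -> term) (es : seq eqn) : Prop :=
  forall e, List.In e es -> subst tau e.1 = subst tau e.2.

Definition general (mu : V -> term) (es : seq eqn) : Prop :=
  forall tau, unifies tau es -> exists delta, tau =1 subst delta \o mu.

Lemma unifies_cons tau e es :
  unifies tau (e :: es) <-> subst tau e.1 = subst tau e.2 /\ unifies tau es.
Proof.
split=> [H|[He Hes] d [<-//|/Hes //]].
by split=> [|d ?]; apply: H; [left|right].
Qed.

Lemma unifies_cat tau es es' :
  unifies tau (es ++ es') <-> unifies tau es /\ unifies tau es'.
Proof.
elim: es => [|e es IH] /=; first by split=> [?|[]//]; split=> // ? [].
by rewrite !unifies_cons IH; tauto.
Qed.

Lemma unifies_swap tau s t es :
  unifies tau ((s, t) :: es) <-> unifies tau ((t, s) :: es).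
Proof. by rewrite !unifies_cons /=; split=> -[-> ?]. Qed.

Definition args_eqs f (ts us : {ffun 'I_(ar f) -> term}) : seq eqn :=
  [seq (ts i, us i) | i <- enum 'I_(ar f)].

Lemma unifies_args tau f (ts us : {ffun 'I_(ar f) -> term}) :
  unifies tau (args_eqs ts us) <-> subst tau (App ts) = subst tau (App us).
Proof.
have in_args i : List.In (ts i, us i) (args_eqs ts us).
  rewrite /args_eqs; have := mem_enum 'I_(ar f) i; rewrite inE.
  elim: (enum _) => [//|j s IH]; rewrite inE => /orP[/eqP ->|/IH]; [by left|by right].
split=> [H|/App_inj/ffunP H e].
  by congr App; apply/ffunP => i; rewrite !ffunE; apply: (H (ts i, us i)).
rewrite /args_eqs; elim: (enum _) => [//|i s IH] [<-|//] /=.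
by have := H i; rewrite !ffunE.
Qed.

Lemma unifies_elim tau x t es : tau x = subst tau t ->
  unifies tau [seq (subst (upd Var x t) e.1, subst (upd Var x t) e.2) | e <- es]
  <-> unifies tau es.
Proof.
move=> e.
have sE u : subst tau (subst (upd Var x t) u) = subst tau u.
  by rewrite subst_comp; apply: eq_subst => y /=; rewrite /upd; case: eqP => [->|].
elim: es => [//|d es IH]; rewrite [map _ _]/= !unifies_cons /= !sE; tauto.
Qed.

Definition lhs_size tau (es : seq eqn) : nat :=
  \sum_(e <- es) term_size (subst tau e.1).

(* Termination of unification is measured along one fixed unifier [tau]:
   eliminating a variable does not change the instances under [tau]. *)
Lemma unifies_mgu es tau : unifies tau es ->
  exists2 mu, unifies mu es & general mu es.
Proof.
have : lhs_size tau es < (lhs_size tau es).+1 by [].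
move: {2}(_.+1) => n; elim: n es => [//|n IH] [|[s t] es].
  by move=> _ _; exists Var => [? []|tau' _]; exists tau'.
rewrite /lhs_size big_cons ltnS /= => sz.
(* Elimination of [x]. The size bound is put on [u], the side opposite to [x]; under [tau] both
   sides have the same instance, so it serves for either orientation of the equation. *)
have elim_var x u : u <> Var x -> term_size (subst tau u) + lhs_size tau es <= n ->
    unifies tau ((Var x, u) :: es) ->
    exists2 mu, unifies mu ((Var x, u) :: es) & general mu ((Var x, u) :: es).
  move=> ux sz' /unifies_cons[/= eu ues].
  have xu : x \notin vars u by apply: contra_notN ux => /occurs_check/(_ eu).
  have [||mu mu_es mu_gen] :=
    IH [seq (subst (upd Var x u) e.1, subst (upd Var x u) e.2) | e <- es].
  - apply: leq_trans sz'; rewrite /lhs_size big_map -add1n.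
    apply: leq_add; first exact: term_size_gt0.
    apply: leq_sum => d _ /=; rewrite subst_comp; apply: eq_leq; congr term_size.
    by apply: eq_subst => y /=; rewrite /upd; case: eqP => [->|].
  - exact/unifies_elim.
  have e_mu : (subst mu \o upd Var x u) x = subst (subst mu \o upd Var x u) u.
    rewrite /= {1}/upd eqxx -subst_comp subst_upd_notin // subst_Var //.
  exists (subst mu \o upd Var x u).
    apply/unifies_cons; split=> //.
    move=> d /(List.in_map (fun e => (subst (upd Var x u) e.1, subst (upd Var x u) e.2))).
    by move=> /mu_es /=; rewrite !subst_comp.
  move=> tau' /unifies_cons[/= e' /(unifies_elim _ e')/mu_gen[delta tau'E]].
  exists delta => y /=; rewrite subst_comp -(eq_subst _ tau'E) /upd.
  by case: eqP => [->|].
case: s sz => [x|f ts] sz.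
  have [-> /unifies_cons[_ ues]|tx] := pselect (t = Var x).
    have [|mu mu_es mu_gen] := IH es _ ues.
      by apply: leq_trans sz; rewrite -add1n leq_add ?term_size_gt0.
    exists mu; first exact/unifies_cons.
    by move=> tau' /unifies_cons[_ /mu_gen].
  move=> ut; apply: elim_var => //.
  by move/unifies_cons: (ut) sz => [/= <- _].
case: t => [x|g us].
  move=> /unifies_swap /elim_var[//|//|mu /unifies_swap mu_es mu_gen].
  by exists mu => // tau' /unifies_swap /mu_gen.
move=> ut; have fg : f = g by move/unifies_cons: (ut) => [/= /App_head].
case: _ / fg us ut => us /unifies_cons[/= ut ues].
(* Decomposition: replacing the two applications by their argument equations drops the weight of the
   head symbol. *)
have [||mu /unifies_cat[mu_a mu_es] mu_gen] := IH (args_eqs ts us ++ es).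
- apply: leq_trans sz; rewrite /lhs_size big_cat /= -addSn leq_add2r.
  rewrite big_map big_enum /= ltnS leqW //.
  by apply: leq_sum => i _; rewrite ffunE.
- by apply/unifies_cat; split=> //; apply/unifies_args.
exists mu; first by apply/unifies_cons; split=> //; apply/unifies_args.
by move=> tau' /unifies_cons[/unifies_args a b]; apply: mu_gen; apply/unifies_cat.
Qed.

Lemma mgu_exists tau (s t : term) : unifier tau s t -> exists mu, mgu mu s t.
Proof.
move=> ust; have [|mu mu_u mu_gen] := @unifies_mgu [:: (s, t)] tau.
  by apply/unifies_cons; split=> // ? [].
exists mu; split; first by move/unifies_cons: mu_u => [].
by move=> tau' u'; apply: mu_gen; apply/unifies_cons; split=> // ? [].
Qed.

(** * Renaming apart *)

Lemma fresh_variable (V_infinite : infinite_set [set: V]) (s : seq V) :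
  exists x, x \notin s.
Proof.
apply: contrapT => no; apply: V_infinite.
rewrite (_ : [set: V] = [set` s]); first exact: finite_seq.
apply/seteqP; split=> // x _ /=; apply: contrapT => xs.
by apply: no; exists x; apply/negP.
Qed.

Definition swap (a b x : V) : V :=
  if x == a then b else if x == b then a else x.

Lemma swapK a b : involutive (swap a b).
Proof.
move=> x; rewrite /swap; case: (eqVneq x a) => [->|xa].
  by rewrite eqxx; case: eqP.
case: (eqVneq x b) => [->|xb]; first by rewrite eqxx.
by rewrite (negbTE xa) (negbTE xb).
Qed.

(** A variant requires a bijection of all variables, so each clash is removed by a transposition
    with a variable that is fresh both for [ys] and for the images already chosen. *)
Lemma renaming_apart (V_infinite : infinite_set [set: V]) (xs ys : seq V) :
  exists2 rho : V -> V, bijective rho & {in xs, forall x, rho x \notin ys}.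
Proof.
elim: xs => [|x xs [rho rho_bij rhoP]]; first by exists id; first by exists id.
have [z] := fresh_variable V_infinite (ys ++ map rho xs).
rewrite mem_cat negb_or => /andP[zys zxs].
have [xys|xys] := boolP (rho x \in ys); last first.
  by exists rho => // y; rewrite inE => /orP[/eqP -> //|/rhoP].
exists (swap (rho x) z \o rho).
  by apply: bij_comp => //; exists (swap (rho x) z); apply: swapK.
move=> y; rewrite inE /swap => /orP[/eqP ->|yxs] /=; first by rewrite eqxx.
case: eqP => [_ //|_]; case: eqP => [e|_]; last exact: rhoP.
by rewrite -e map_f in zxs.
Qed.

(** * Relative positions of redexes and closure properties of rewriting *)

Lemma fill_eq_App (C : ctx) a f (ts : {ffun 'I_(ar f) -> term}) : fill C a = App ts ->
  C = Hole \/ exists i (ss : {ffun 'I_(ar f) -> term}) C',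
    [/\ C = CApp i ss C', fill C' a = ts i & forall j, j != i -> ss j = ts j].
Proof.
case: C => [|g i ss C'] /=; [by left|move=> e; right].
have fg := App_head e; case: _ / fg ts e => ts /App_inj e.
exists i, ss, C'; split=> // [|j ji].
  by rewrite -e ffunE eqxx.
by rewrite -e ffunE (negbTE ji).
Qed.

(** The cases are one occurrence inside the other, or parallel occurrences. A context stores an
    arbitrary term at the place of its hole, so contexts are compared only after filling. In the
    parallel case [D1] is [C1] with [b2] put at the other occurrence, and [D2] is [C2] with [b1];
    this replaces a context with two holes. *)
Lemma fill_overlap (C1 C2 : ctx) a1 a2 : fill C1 a1 = fill C2 a2 ->
  [\/ exists2 D, a2 = fill D a1 & forall x, fill C1 x = fill C2 (fill D x),
      exists2 D, a1 = fill D a2 & forall x, fill C2 x = fill C1 (fill D x) |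
      forall b1 b2, exists D1 D2,
        [/\ fill C1 b1 = fill D2 a2, fill C2 b2 = fill D1 a1 &
            fill D1 b1 = fill D2 b2]].
Proof.
elim: C1 C2 => [|f i ss C1 IH] C2 e; first by apply: Or32; exists C2.
case: (fill_eq_App (esym e)) => [eC2|[j [us [C2' [eC2]]]]].
  by rewrite eC2 /= in e *; apply: Or31; exists (CApp i ss C1).
move=> {e}; rewrite ffunE {C2}eC2; case: (eqVneq j i) => [->|ji] eC ssE.
  have ssE' x : fill (CApp i us C2') x = fill (CApp i ss C2') x.
    congr App; apply/ffunP => k; rewrite !ffunE; case: ifP => // /negbT ki.
    by rewrite ssE // ffunE (negbTE ki).
  case: (IH C2' (esym eC)) => [[D Da DE]|[D Da DE]|par].
  - by apply: Or31; exists D => // x; rewrite ssE' /= DE.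
  - by apply: Or32; exists D => // x; rewrite ssE' /= DE.
  - apply: Or33 => b1 b2; have [D1 [D2 [e1 e2 e3]]] := par b1 b2.
    by exists (CApp i ss D1), (CApp i ss D2); rewrite ssE' /= e1 e2 e3.
apply: Or33 => b1 b2.
exists (CApp i [ffun k => if k == j then fill C2' b2 else ss k] C1),
  (CApp j [ffun k => if k == i then fill C1 b1 else ss k] C2').
have ij : i != j by rewrite eq_sym.
split; rewrite /=; congr App; apply/ffunP => k; rewrite !ffunE.
- case: (eqVneq k i) => [->|ki]; first by rewrite (negbTE ij).
  by case: (eqVneq k j) => [->|//]; rewrite eC.
- case: (eqVneq k j) => [->|kj]; first by rewrite (negbTE ji).
  have := ssE k kj; rewrite ffunE => ->.
  by case: eqP.
- case: (eqVneq k i) => [->|ki]; first by rewrite (negbTE ij).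
  by case: eqP.
Qed.

Lemma clos_rt_map (S T : Type) (f : S -> T) (A : relation S) (B : relation T) :
  (forall x y, A x y -> B (f x) (f y)) ->
  forall x y, clos_refl_trans _ A x y -> clos_refl_trans _ B (f x) (f y).
Proof.
move=> AB x y; elim=> {x y} [x y /AB|x|x y z _ xy _ yz]; first exact: rt_step.
  exact: rt_refl.
exact: rt_trans xy yz.
Qed.

Lemma clos_rt_sub (S : Type) (A B : relation S) : (forall x y, A x y -> B x y) ->
  forall x y, clos_refl_trans _ A x y -> clos_refl_trans _ B x y.
Proof. exact: (@clos_rt_map S S id A B). Qed.

Lemma clos_rt_sym (S : Type) (A : relation S) : (forall x y, A x y -> A y x) ->
  forall x y, clos_refl_trans _ A x y -> clos_refl_trans _ A y x.
Proof.
move=> As x y; elim=> {x y} [x y /As|x|x y z _ xy _ yz]; first exact: rt_step.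
  exact: rt_refl.
exact: rt_trans yz xy.
Qed.

Lemma rstep_fill X C (s t : term) : rstep X s t -> rstep X (fill C s) (fill C t).
Proof.
move=> [D [l [r [sigma [X_lr -> ->]]]]].
by exists (ctx_comp C D), l, r, sigma; rewrite !fill_comp.
Qed.

Lemma rstep_subst X tau (s t : term) :
  rstep X s t -> rstep X (subst tau s) (subst tau t).
Proof.
move=> [D [l [r [sigma [X_lr -> ->]]]]].
exists (ctx_subst tau D), l, r, (subst tau \o sigma).
by rewrite !subst_fill !subst_comp.
Qed.

Lemma rstep_rule X l r : X (l, r) -> @rstep F ar V X l r.
Proof. by exists Hole, l, r, Var; rewrite /= !subst_Var. Qed.

Lemma rstep_mono (X Y : set eqn) s t : X `<=` Y -> rstep X s t -> rstep Y s t.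
Proof.
by move=> XY [C [l [r [sigma [/XY Ylr es et]]]]]; exists C, l, r, sigma.
Qed.

Lemma estep_instance X C tau (s t : term) : estep X s t ->
  estep X (fill C (subst tau s)) (fill C (subst tau t)).
Proof. by case=> ?; [left|right]; apply/rstep_fill/rstep_subst. Qed.

Lemma estep_sym X (s t : term) : estep X s t -> estep X t s.
Proof. by case; [right|left]. Qed.

Lemma conv_sym X (s t : term) : conv X s t -> conv X t s.
Proof. by apply: clos_rt_sym => x y; apply: estep_sym. Qed.

Lemma conv_instance X C tau (s t : term) : conv X s t ->
  conv X (fill C (subst tau s)) (fill C (subst tau t)).
Proof.
apply: (clos_rt_map (f := fun s => fill C (subst tau s))) => x y.
exact: estep_instance.
Qed.

Lemma conv_subset (X Y : set eqn) s t :
  (forall l r, X (l, r) -> conv Y l r) -> conv X s t -> conv Y s t.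
Proof.
move=> XY; elim=> {s t} [s t|s|s u t _ su _ ut].
- by case=> -[C [l [r [sigma [/XY lr -> ->]]]]]; [|apply: conv_sym];
    apply: conv_instance.
- exact: rt_refl.
- exact: rt_trans su ut.
Qed.

Lemma rsteps_fill X C (s t : term) : rsteps X s t -> rsteps X (fill C s) (fill C t).
Proof. by apply: (clos_rt_map (f := fill C)) => x y; apply: rstep_fill. Qed.

Lemma rsteps_args X f (ts us : {ffun 'I_(ar f) -> term}) :
  (forall i, rsteps X (ts i) (us i)) -> rsteps X (App ts) (App us).
Proof.
move=> tus.
(* Arguments are rewritten one at a time; [mix s] has those listed in [s] already done, and a
   repeated index costs no step. *)
pose mix (s : seq 'I_(ar f)) : {ffun 'I_(ar f) -> term} :=
  [ffun i => if i \in s then us i else ts i].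
suff H s : rsteps X (App ts) (App (mix s)).
  rewrite (_ : us = mix (enum 'I_(ar f))); first exact: H.
  by apply/ffunP => i; rewrite ffunE mem_enum.
elim: s => [|i s IH].
  by rewrite (_ : mix [::] = ts); [exact: rt_refl|apply/ffunP => i; rewrite ffunE].
apply: rt_trans IH _.
have -> : App (mix s) = fill (CApp i (mix s) Hole) (mix s i).
  by congr App; apply/ffunP => k; rewrite !ffunE; case: eqP => [->|].
have -> : App (mix (i :: s)) = fill (CApp i (mix s) Hole) (us i).
  congr App; apply/ffunP => k; rewrite !ffunE inE.
  by case: eqP => [->|].
apply: rsteps_fill; rewrite ffunE; case: ifP => _ //; exact: rt_refl.
Qed.

Lemma rsteps_subst X sigma tau t : (forall x, rsteps X (sigma x) (tau x)) ->
  @rsteps F ar V X (subst sigma t) (subst tau t).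
Proof.
move=> st; elim/term_ind_args: t => [x|f ts IH]; first exact: st.
by apply: rsteps_args => i; rewrite !ffunE.
Qed.

Lemma subterm_at_vars (t : term) p u :
  subterm_at t p = Some u -> {subset vars u <= vars t}.
Proof.
elim: p t => [|i p IH] t; first by rewrite subterm_at_nil => -[->].
case: t => [//|f ts] /=; case: insubP => [j _ _ /IH sub|//] x /sub xj.
by apply/vars_AppP; exists j.
Qed.

(** Either the hole of [D] is at a function position of [l], or it lies inside some [sigma x]. In
    the second case [x] may occur several times in [l], so after rewriting one copy the others are
    rewritten too, which gives an instance of [l] again. In the first case [tau] only has to agree
    with [sigma] on [l], which leaves it free on the variables of the other rule after renaming
    apart. *)
Lemma critical_or_variable_overlap (l : term) D a sigma : subst sigma l = fill D a ->
  (exists p w, [/\ subterm_at l p = Some w, ~~ is_var w, a = subst sigma w &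
     forall tau r, {in vars l, tau =1 sigma} ->
       subst tau (replace_at l p r) = fill D (subst tau r)]) \/
  (forall X b, rsteps X a b -> exists2 tau,
     forall x, rsteps X (sigma x) (tau x) & rsteps X (fill D b) (subst tau l)).
Proof.
elim/term_ind_args: l D => [x|f ts IH] D e.
  right=> X b ab; exists (upd sigma x (fill D b)) => [y|].
    rewrite /upd; case: eqP => [->|_]; last exact: rt_refl.
    by move: e => /= ->; apply: rsteps_fill.
  by rewrite /= /upd eqxx; apply: rt_refl.
case: (fill_eq_App (esym e)) => [eD|[i [ss [D' [-> eD ssE]]]]].
  left; exists [::], (App ts); rewrite subterm_at_nil; split=> //.
    by rewrite e eD.
  by move=> tau r _; rewrite replace_at_nil eD.
rewrite ffunE in eD; case: (IH i D' (esym eD)) => [[p [w [pw wv aw rE]]]|var].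
  left; exists (val i :: p), w; split=> //=; first by rewrite valK.
  move=> tau r ts_eq; congr App; apply/ffunP => j; rewrite !ffunE.
  rewrite val_eqE; case: eqP => [->|/eqP ji].
    by apply: rE => x xi; apply: ts_eq; apply/vars_AppP; exists i.
  rewrite ssE // ffunE; apply: eq_in_subst => x xj.
  by apply: ts_eq; apply/vars_AppP; exists j.
(* The other arguments may share the changed variable, so they follow [tau] as well. *)
right=> X b /var[tau st Db]; exists tau => //.
apply: rsteps_args => j; rewrite !ffunE; case: eqP => [->//|/eqP ji].
by rewrite ssE // ffunE; apply: rsteps_subst.
Qed.

End TermFacts.

(** * Reduction orders and connectedness below peaks *)

Section Orders.

Variables (F : Type) (ar : F -> nat) (V : eqType).

Local Notation term := (term ar V).
Local Notation eqn := (eqn ar V).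

Variables (gt : relation term) (gt_ro : reduction_order gt).

Definition ge (s t : term) : Prop := gt s t \/ s = t.

Lemma gt_asym s t : gt s t -> ~ gt t s.
Proof. by move=> st ts; apply: (ro_irrefl gt_ro (ro_trans gt_ro st ts)). Qed.

Lemma gt_ge_trans s t u : gt s t -> ge t u -> gt s u.
Proof. by move=> st [/(ro_trans gt_ro st)|<-]. Qed.

Lemma ge_instance C tau s t :
  ge s t -> ge (fill C (subst tau s)) (fill C (subst tau t)).
Proof. by case=> [?|->]; [left; apply/(ro_ctx gt_ro)/(ro_subst gt_ro)|right]. Qed.

(** Otherwise wrapping [C] around repeatedly would give an infinite descent from [t]. *)
Lemma not_gt_fill C t : ~ gt t (fill C t).
Proof.
elim: (ro_wf gt_ro t) => {}t _ IH t_gt.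
by apply: (IH _ t_gt); apply: (ro_ctx gt_ro).
Qed.

Lemma subst_occurrence sigma x (t : term) :
  x \in vars t -> exists C, subst sigma t = fill C (sigma x).
Proof.
elim/term_ind_args: t => [y|f ts IH].
  by rewrite inE => /eqP ->; exists (Hole _ _).
case/vars_AppP => i /IH[C e].
exists (CApp i [ffun j => subst sigma (ts j)] C) => /=.
by congr App; apply/ffunP => j; rewrite !ffunE; case: eqP => [->|].
Qed.

Definition ordered (X : set eqn) : Prop := forall l r, X (l, r) -> gt l r.

(** If [x] occurs in the right-hand side only, instantiating it by the left-hand side [l'] puts [l']
    above a term containing [l']. A variable left-hand side is excluded likewise, or by
    instantiating it by [r], which gives [gt r r]. *)
Lemma ordered_is_trs X : ordered X -> is_trs X.
Proof.
move=> Xgt l r /Xgt {Xgt}; have sub l' r' : gt l' r' -> {subset vars r' <= vars l'}.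
  move=> gt_lr x xr; apply: contrapT => /negP xl.
  have [C e] := subst_occurrence (upd (@Var _ ar V) x l') xr.
  have := ro_subst gt_ro (upd (@Var _ ar V) x l') gt_lr.
  by rewrite e subst_upd_notin // subst_Var /upd eqxx => /not_gt_fill.
move=> gt_lr; split; last exact: sub.
case: l gt_lr => [x|//] gt_xr; apply/negP => _.
have [xr|xr] := boolP (x \in vars r).
  have [C] := subst_occurrence (@Var _ ar V) xr.
  by rewrite subst_Var => e; rewrite e in gt_xr; apply: not_gt_fill gt_xr.
have := ro_subst gt_ro (upd (@Var _ ar V) x r) gt_xr.
by rewrite (subst_upd_notin _ _ xr) subst_Var /= /upd eqxx => /(ro_irrefl gt_ro).
Qed.

Lemma rstep_gt X s t : ordered X -> rstep X s t -> gt s t.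
Proof.
move=> Xgt [C [l [r [sigma [/Xgt gt_lr -> ->]]]]].
exact/(ro_ctx gt_ro)/(ro_subst gt_ro).
Qed.

Lemma ordered_terminating X : ordered X -> terminating X.
Proof.
move=> Xgt s; elim: (ro_wf gt_ro s) => {}s _ IH.
by constructor => t /(rstep_gt Xgt) /IH.
Qed.

(** [P] is imposed on both ends of every step; the empty conversion carries no condition. *)
Definition bounded_conv (X : set eqn) (P : term -> Prop) : relation term :=
  clos_refl_trans _ (fun s t => [/\ P s, P t & estep X s t]).

Lemma bounded_conv_conv X P s t : bounded_conv X P s t -> conv X s t.
Proof. by apply: clos_rt_sub => x y []. Qed.

Lemma bounded_conv_sym X P s t : bounded_conv X P s t -> bounded_conv X P t s.
Proof. by apply: clos_rt_sym => x y [? ? /estep_sym]. Qed.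

Lemma bounded_conv_mono X (P Q : term -> Prop) s t : (forall v, P v -> Q v) ->
  bounded_conv X P s t -> bounded_conv X Q s t.
Proof. by move=> PQ; apply: clos_rt_sub => x y [/PQ ? /PQ ?]. Qed.

Lemma bounded_conv_instance X (P Q : term -> Prop) C tau s t :
  (forall v, P v -> Q (fill C (subst tau v))) -> bounded_conv X P s t ->
  bounded_conv X Q (fill C (subst tau s)) (fill C (subst tau t)).
Proof.
move=> PQ; apply: (clos_rt_map (f := fun s => fill C (subst tau s))) => x y.
by move=> [/PQ ? /PQ ? /(estep_instance C tau)].
Qed.

Lemma bounded_conv_fill X (P Q : term -> Prop) C s t :
  (forall v, P v -> Q (fill C v)) -> bounded_conv X P s t ->
  bounded_conv X Q (fill C s) (fill C t).
Proof.
move=> PQ; rewrite -{2}(subst_Var s) -{2}(subst_Var t).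
by apply: bounded_conv_instance => v; rewrite subst_Var; apply: PQ.
Qed.

Lemma rsteps_bounded X u s t : ordered X -> gt u s -> rsteps X s t ->
  bounded_conv X (gt u) s t /\ gt u t.
Proof.
move=> Xgt us st; elim: st us => {s t} [s t st|s|s v t _ IHsv _ IHvt] us.
- have ut := ro_trans gt_ro us (rstep_gt Xgt st).
  by split=> //; apply: rt_step; split=> //; left.
- by split=> //; apply: rt_refl.
- have [sv /IHvt[vt ut]] := IHsv us.
  by split=> //; apply: rt_trans sv vt.
Qed.

Lemma joinable_bounded X u s t : ordered X -> gt u s -> gt u t ->
  joinable X s t -> bounded_conv X (gt u) s t.
Proof.
move=> Xgt us ut [v /(rsteps_bounded Xgt us)[sv _] /(rsteps_bounded Xgt ut)[tv _]].
exact: rt_trans sv (bounded_conv_sym tv).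
Qed.

(* Newman's lemma with local joinability weakened to connectedness below the
   peak, after Winkler and Buchberger. *)
Lemma confluent_below_peaks X : ordered X ->
  (forall u s t, rstep X u s -> rstep X u t -> bounded_conv X (gt u) s t) ->
  confluent X.
Proof.
move=> Xgt peak u; elim: (ro_wf gt_ro u) => {}u _ IH.
(* A conversion below [u] is joined step by step: a step taken backwards from [v] opens a peak at
   [v], which is below [u] and so confluent by induction. *)
have CR s t : bounded_conv X (gt u) s t -> joinable X s t.
  move=> st; elim: {st}(clos_rt_rt1n _ _ _ _ st) => {s t} [s|s v t [us uv sv] _ [w vw tw]].
    by exists s; apply: rt_refl.
  case: sv => [sv|vs].
    by exists w => //; apply: rt_trans (rt_step _ _ _ _ sv) vw.
  have [z sz wz] := IH v uv s w (rt_step _ _ _ _ vs) vw.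
  by exists z => //; apply: rt_trans tw wz.
move=> s t us ut.
case: {us}(clos_rt_rt1n _ _ _ _ us) => [|s1 s' us1 s1s'].
  by exists t; [|apply: rt_refl].
have {s1s'} s1s := clos_rt1n_rt _ _ _ _ s1s'.
case: {ut}(clos_rt_rt1n _ _ _ _ ut) => [|t1 t' ut1 t1t'].
  exists s'; first exact: rt_refl.
  by apply: rt_trans s1s; apply: rt_step.
have {t1t'} t1t := clos_rt1n_rt _ _ _ _ t1t'.
have [a s1a t1a] := CR _ _ (peak _ _ _ us1 ut1).
have [b sb ab] := IH _ (rstep_gt Xgt us1) _ _ s1s s1a.
have [c bc tc] := IH _ (rstep_gt Xgt ut1) _ _ (rt_trans _ _ _ _ _ t1a ab) t1t.
by exists c => //; apply: rt_trans sb bc.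
Qed.

(** Both rules may be the same, so the first one is renamed apart. Then [tau] combines [s1] and [s2]
    into a single unifier and factors through an mgu. Strict orientation and asymmetry supply all
    the order conditions. *)
Lemma LCP_instance (V_infinite : infinite_set [set: V]) X l1 r1 s1 l2 r2 s2 D p w :
  ordered X -> X (l1, r1) -> X (l2, r2) ->
  subterm_at l2 p = Some w -> ~~ is_var w -> subst s1 l1 = subst s2 w ->
  (forall tau r, {in vars l2, tau =1 s2} ->
     subst tau (replace_at l2 p r) = fill D (subst tau r)) ->
  exists s t delta, [/\ LCP gt X (s, t),
    subst delta s = fill D (subst s1 r1) & subst delta t = subst s2 r2].
Proof.
move=> Xgt X1 X2 pw wv e12 rE.
have [rho [rho' rhoK rho'K] rho_apart] := renaming_apart V_infinite
  (vars l1 ++ vars r1) (vars l2 ++ vars r2).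
pose tau y := if y \in vars l2 ++ vars r2 then s2 y else s1 (rho' y).
have tau1 u : {subset vars u <= vars l1 ++ vars r1} ->
    subst tau (rename rho u) = subst s1 u.
  move=> sub; rewrite /rename subst_comp; apply: eq_in_subst => x /sub x1 /=.
  by rewrite /tau (negbTE (rho_apart x x1)) rhoK.
have tau2 x : x \in vars l2 ++ vars r2 -> tau x = s2 x by rewrite /tau => ->.
have tau2l : {in vars l2, tau =1 s2}.
  by move=> x xl; apply: tau2; rewrite mem_cat xl.
have tau2r : {in vars r2, tau =1 s2}.
  by move=> x xr; apply: tau2; rewrite mem_cat xr orbT.
have sub_l : {subset vars l1 <= vars l1 ++ vars r1}.
  by move=> x xl; rewrite mem_cat xl.
have sub_r : {subset vars r1 <= vars l1 ++ vars r1}.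
  by move=> x xr; rewrite mem_cat xr orbT.
have utau : unifier tau (rename rho l1) w.
  rewrite /unifier tau1 // e12; apply: eq_in_subst => x xw.
  by rewrite tau2l // (subterm_at_vars pw).
have [mu mu_mgu] := mgu_exists utau.
have [delta tauE] := mu_mgu.2 _ utau.
have deltaE u : subst delta (subst mu u) = subst tau u.
  by rewrite subst_comp; apply: eq_subst => x; rewrite tauE.
have gt1 : gt (rename rho l1) (rename rho r1) by apply/(ro_subst gt_ro)/Xgt.
exists (subst mu (replace_at l2 p (rename rho r1))), (subst mu r2), delta.
split; [|by rewrite deltaE (rE _ _ tau2l) tau1|by rewrite deltaE (eq_in_subst tau2r)].
exists (rename rho l1), (rename rho r1), p, l2, r2, mu; split=> //; last first.
  by left; split=> //; apply/gt_asym/Xgt.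
split.
- exists (l1, r1); first by left.
  by exists rho => //; exists rho'.
- exists (l2, r2); first by left.
  by exists id; [exists id|rewrite /rename !subst_Var].
- apply/hasPn => y /= y2; apply/negP => y1.
  have [x x1 ey] : exists2 x, x \in vars l1 ++ vars r1 & y = rho x.
    move: y1; rewrite mem_cat => /orP[] /mem_vars_rename[x xl ->];
      by exists x => //; rewrite mem_cat xl ?orbT.
  by move: y2; rewrite ey (negbTE (rho_apart x x1)).
- by exists w.
- by apply/gt_asym/(ro_subst gt_ro).
- by apply/gt_asym/(ro_subst gt_ro)/Xgt.
Qed.

Lemma nested_peak_bounded (V_infinite : infinite_set [set: V]) X : ordered X ->
  (forall s t u delta, LCP gt X (s, t) -> gt u (subst delta s) ->
     gt u (subst delta t) -> bounded_conv X (gt u) (subst delta s) (subst delta t)) ->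
  forall l1 r1 s1 l2 r2 s2 D, X (l1, r1) -> X (l2, r2) ->
    subst s2 l2 = fill D (subst s1 l1) ->
    bounded_conv X (gt (subst s2 l2)) (fill D (subst s1 r1)) (subst s2 r2).
Proof.
move=> Xgt cp l1 r1 s1 l2 r2 s2 D X1 X2 e.
have gt1 : gt (subst s2 l2) (fill D (subst s1 r1)).
  by rewrite e; apply/(ro_ctx gt_ro)/(ro_subst gt_ro)/Xgt.
have gt2 : gt (subst s2 l2) (subst s2 r2) by apply/(ro_subst gt_ro)/Xgt.
case: (critical_or_variable_overlap e) => [[p [w [pw wv e1 rE]]]|var].
  have [s [t [delta [st es et]]]] :=
    LCP_instance V_infinite Xgt X1 X2 pw wv e1 rE.
  by rewrite -es -et; apply: cp => //; rewrite ?es ?et.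
have step1 : rsteps X (subst s1 l1) (subst s1 r1).
  by apply/rt_step/rstep_subst/rstep_rule.
(* Variable overlap: both sides of the peak reach [subst tau r2], one through the repaired instance
   of [l2], the other by rewriting inside the substitution. *)
have [tau s2_tau D_tau] := var _ _ step1.
apply: joinable_bounded => //; exists (subst tau r2).
  by apply: rt_trans D_tau _; apply/rt_step/rstep_subst/rstep_rule.
exact: rsteps_subst.
Qed.

Lemma peak_bounded (V_infinite : infinite_set [set: V]) X : ordered X ->
  (forall s t u delta, LCP gt X (s, t) -> gt u (subst delta s) ->
     gt u (subst delta t) -> bounded_conv X (gt u) (subst delta s) (subst delta t)) ->
  forall u s t, rstep X u s -> rstep X u t -> bounded_conv X (gt u) s t.
Proof.
move=> Xgt cp u s t us ut.
have [gt_us gt_ut] := (rstep_gt Xgt us, rstep_gt Xgt ut).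
case: us ut => [C1 [l1 [r1 [s1 [X1 eu es]]]]] [C2 [l2 [r2 [s2 [X2 eu' et]]]]].
have := eu; rewrite {1}eu' => /fill_overlap[[D eD CD]|[D eD CD]|par].
- apply: bounded_conv_sym; rewrite es et CD.
  apply: bounded_conv_fill (nested_peak_bounded V_infinite Xgt cp X2 X1 eD).
  by move=> v /(ro_ctx gt_ro C1); rewrite -eu.
- rewrite es et CD.
  apply: bounded_conv_fill (nested_peak_bounded V_infinite Xgt cp X1 X2 eD).
  by move=> v /(ro_ctx gt_ro C2); rewrite -eu'.
- have [D1 [D2 [e1 e2 e3]]] := par (subst s2 r2) (subst s1 r1).
  apply: joinable_bounded => //; exists (fill D1 (subst s2 r2)).
    by rewrite es e2; apply/rt_step/rstep_fill/rstep_subst/rstep_rule.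
  by rewrite et e1 e3; apply/rt_step/rstep_fill/rstep_subst/rstep_rule.
Qed.

End Orders.

(** * Bounded conversions along a run *)

Section Runs.

Variables (F : Type) (ar : F -> nat) (V : eqType).

Local Notation term := (term ar V).
Local Notation eqn := (eqn ar V).

Variables (gt : relation term) (gt_ro : reduction_order gt).

Lemma conv_rule (X : set eqn) l r : X (l, r) -> conv X l r.
Proof. by move=> Xlr; apply: rt_step; left; apply: rstep_rule. Qed.

Lemma rstep_conv (X Y : set eqn) s t : X `<=` Y -> rstep X s t -> conv Y s t.
Proof. by move=> XY st; apply: rt_step; left; apply: rstep_mono st. Qed.

Lemma rstep_pm_conv (E R : set eqn) s t :
  rstep (pm E `|` R) s t -> conv (E `|` R) s t.
Proof.
move=> st; have {st} : conv (pm E `|` R) s t by apply: rt_step; left.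
apply: conv_subset => l r [[Elr|[[r' l'] Erl [<- <-]]]|Rlr].
- by apply: conv_rule; left.
- by apply: conv_sym; apply: conv_rule; left.
- by apply: conv_rule; right.
Qed.

Lemma kbl_ordered ER ER' :
  kbl gt ER ER' -> ordered gt ER.2 -> ordered gt ER'.2.
Proof.
case=> {ER ER'} //=.
- by move=> E R s t _ st Rgt l r [/Rgt //|[-> ->]].
- by move=> E R s t _ st Rgt l r [/Rgt //|[-> ->]].
- move=> E R s t u _ tu Rgt l r [Rlr|[-> ->]]; first by apply: Rgt; left.
  apply: (ro_trans gt_ro (Rgt s t _)); first by right.
  by apply: (rstep_gt gt_ro) tu => l' r' Rlr; apply: Rgt; left.
- by move=> E R t s u l r _ _ _ _ Rgt l' r' Rlr; apply: Rgt; left.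
Qed.

(** Soundness of one inference. The converse inclusion, that no initial equation is lost, is drawn
    from [union_eqn_bconv] instead. *)
Lemma kbl_conv ER ER' : kbl gt ER ER' ->
  forall s t, conv (ER'.1 `|` ER'.2) s t -> conv (ER.1 `|` ER.2) s t.
Proof.
move=> st s0 t0; apply: conv_subset.
case: st => {ER ER' s0 t0} /=.
- move=> E R s t u us ut _ l r [[Elr|[-> ->]]|Rlr].
  + by apply: conv_rule; left.
  + apply: rt_trans (rstep_pm_conv ut).
    exact/conv_sym/rstep_pm_conv.
  + by apply: conv_rule; right.
- move=> E R s t _ _ l r [Elr|[Rlr|[-> ->]]]; apply: conv_rule.
  + by left; left.
  + by right.
  + by left; right.
- move=> E R s t _ _ l r [Elr|[Rlr|[-> ->]]].
  + by apply: conv_rule; left; left.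
  + by apply: conv_rule; right.
  + by apply/conv_sym/conv_rule; left; right.
- move=> E R s _ l r [Elr|Rlr]; apply: conv_rule; [by left; left|by right].
- move=> E R s t u _ tu l r [Elr|[Rlr|[-> ->]]].
  + by apply: conv_rule; left.
  + by apply: conv_rule; right; left.
  + apply: rt_trans (conv_rule _) (rstep_conv _ tu); first by right; right.
    by move=> e Re; right; left.
- move=> E R s t u _ su l r [[Elr|[-> ->]]|Rlr].
  + by apply: conv_rule; left; left.
  + apply: rt_trans (conv_sym (rstep_conv _ su)) (conv_rule _).
      by move=> e Re; right.
    by left; right.
  + by apply: conv_rule; right.
- move=> E R s t u _ tu l r [[Elr|[-> ->]]|Rlr].
  + by apply: conv_rule; left; left.
  + apply: rt_trans (conv_rule _) (rstep_conv _ tu); first by left; right.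
    by move=> e Re; right.
  + by apply: conv_rule; right.
- move=> E R t s u l' r' _ Rlr' tu _ l r [[Elr|[-> ->]]|Rlr].
  + by apply: conv_rule; left.
  + apply: rt_trans (conv_sym (rstep_conv _ tu)) (conv_rule _).
      by move=> _ ->; right; left.
    by right; right.
  + by apply: conv_rule; right; left.
Qed.

Lemma kbl_removed_eqn ER ER' s t : kbl gt ER ER' ->
  ER.1 (s, t) -> ~ ER'.1 (s, t) ->
  [\/ gt s t /\ ER'.2 (s, t), gt t s /\ ER'.2 (t, s), s = t |
    (exists2 u, rstep ER.2 s u & ER'.1 (u, t)) \/
    (exists2 u, rstep ER.2 t u & ER'.1 (s, u))].
Proof.
case=> {ER ER'} /=.
- by move=> E R s' t' u _ _ _ Est []; left.
- by move=> E R s' t' _ gt_st [//|[-> ->]] _; apply: Or41; split=> //; right.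
- by move=> E R s' t' _ gt_ts [//|[-> ->]] _; apply: Or42; split=> //; right.
- by move=> E R s' _ [//|[-> ->]] _; apply: Or43.
- by [].
- move=> E R s' t' u _ su [Est []|[-> ->] _]; first by left.
  by apply: Or44; left; exists u => //; right.
- move=> E R s' t' u _ tu [Est []|[-> ->] _]; first by left.
  by apply: Or44; right; exists u => //; right.
- by move=> E R t' s' u l r _ _ _ _ Est []; left.
Qed.

Lemma kbl_removed_rule ER ER' l r : kbl gt ER ER' ->
  ER.2 (l, r) -> ~ ER'.2 (l, r) ->
  (exists2 u, rstep ER.2 r u & ER'.2 (l, u)) \/
  exists u l' r', [/\ ER.2 (l', r'), rstep [set (l', r')] l u,
    properly_encompasses l l' & ER'.1 (u, r)].
Proof.
case=> {ER ER'} //=.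
- by move=> E R s t _ _ Rlr []; left.
- by move=> E R s t _ _ Rlr []; left.
- move=> E R s t u _ tu [Rlr []|[-> ->] _]; first by left.
  by left; exists u; [apply: rstep_mono tu|right].
- move=> E R t s u l' r' _ Rlr' tu enc [//|[-> ->] _].
  by right; exists u, l', r'; split=> //; [left|right].
Qed.

(** The index [j] is not compared with [i]: the later inductions run over terms and speak of
    everything that ever occurs, whatever the time. *)
Lemma persistent_or_removed (X : nat -> set eqn) i e : X i e ->
  persistent X e \/ exists j, X j e /\ ~ X j.+1 e.
Proof.
move=> Xi; apply: contrapT => /not_orP[npers nrem]; apply: npers.
exists i => // j /=; elim: j => [|j IH]; first by rewrite leqn0 => /eqP <-.
rewrite leq_eqVlt => /orP[/eqP <- //|/IH Xj].
by apply: contrapT => nX; apply: nrem; exists j.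
Qed.

Lemma persistent_union (X : nat -> set eqn) : persistent X `<=` union_set X.
Proof. by move=> e [i _ /(_ i (leqnn i)) Xi]; exists i. Qed.

Variables E R : nat -> set eqn.
Hypothesis run : infinite_run gt E R.
Hypothesis R0 : R 0 = set0.
Hypothesis Eomega : persistent E = set0.

Lemma run_rules_ordered i : ordered gt (R i).
Proof.
elim: i => [|i IH]; first by rewrite R0.
exact: kbl_ordered (run i) IH.
Qed.

Lemma persistent_rules_ordered : ordered gt (persistent R).
Proof. by move=> l r /persistent_union[i _ /run_rules_ordered]. Qed.

Lemma run_conv i s t : conv (E i `|` R i) s t -> conv (E 0) s t.
Proof.
elim: i s t => [|i IH] s t; first by rewrite R0 setU0.
by move=> /(kbl_conv (run i)) /IH.
Qed.

Let bconv := bounded_conv (persistent R).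
Let rule_ok l r := bconv (ge gt l) l r.
Let eqn_ok s t := bconv (fun v => ge gt s v \/ ge gt t v) s t.

Lemma rstep_bconv i s u :
  (forall l r, union_set R (l, r) -> encompasses s l -> rule_ok l r) ->
  rstep (R i) s u -> bconv (ge gt s) s u.
Proof.
move=> ok [C [l [r [sigma [Rlr es ->]]]]].
have : rule_ok l r by apply: ok; [exists i|exists C, sigma].
rewrite {2}es; apply: bounded_conv_instance => v.
by rewrite es; apply: ge_instance.
Qed.

(** Induction on [s], then on [t], since simplification lowers one side and keeps the other. The
    assumption on rules is local to terms below [s] or [t], so that the lemma applies inside the
    induction of [rule_bconv], where only such rules are under control. *)
Lemma eqn_bconv s t :
  (forall m l r, ge gt s m \/ ge gt t m -> union_set R (l, r) ->
     encompasses m l -> rule_ok l r) ->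
  union_set E (s, t) -> eqn_ok s t.
Proof.
have ge_trans u v w : gt u v -> ge gt v w -> ge gt u w.
  by move=> uv vw; left; apply: gt_ge_trans uv vw.
elim: (ro_wf gt_ro s) t => {}s _ IHs t.
elim: (ro_wf gt_ro t) => {}t _ IHt ok [i _ Est].
have [|[j [Ej Ej1]]] := persistent_or_removed Est; first by rewrite Eomega.
have ok_s l r : union_set R (l, r) -> encompasses s l -> rule_ok l r.
  by apply: ok; left; right.
have ok_t l r : union_set R (l, r) -> encompasses t l -> rule_ok l r.
  by apply: ok; right; right.
have self (u : term) : encompasses u u.
  by exists (Hole _ _), (@Var _ ar V); rewrite /= subst_Var.
case: (kbl_removed_eqn (run j) Ej Ej1) => /=.
- move=> [_ Rst]; have : rule_ok s t by apply: ok_s => //; exists j.+1.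
  by apply: bounded_conv_mono => v; left.
- move=> [_ Rts]; have : rule_ok t s by apply: ok_t => //; exists j.+1.
  move=> /bounded_conv_sym; by apply: bounded_conv_mono => v; right.
- by move=> ->; apply: rt_refl.
- case=> -[u su Eu].
  + have gt_su := rstep_gt gt_ro (@run_rules_ordered j) su.
    have b_su := rstep_bconv ok_s su.
    have b_ut : eqn_ok u t.
      apply: IHs => // [m l r um|]; last by exists j.+1.
      by apply: ok; case: um => [/(ge_trans _ _ _ gt_su)|]; [left|right].
    apply: (rt_trans _ _ _ u).
      by apply: bounded_conv_mono b_su => v; left.
    apply: bounded_conv_mono b_ut => v.
    by move=> [/(ge_trans _ _ _ gt_su)|]; [left|right].
  + have gt_tu := rstep_gt gt_ro (@run_rules_ordered j) su.
    have b_tu := rstep_bconv ok_t su.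
    have b_su : eqn_ok s u.
      apply: IHt => // [m l r um|]; last by exists j.+1.
      by apply: ok; case: um => [|/(ge_trans _ _ _ gt_tu)]; [left|right].
    apply: (rt_trans _ _ _ u); last first.
      by apply/bounded_conv_sym; apply: bounded_conv_mono b_tu => v; right.
    apply: bounded_conv_mono b_su => v.
    by move=> [|/(ge_trans _ _ _ gt_tu)]; [left|right].
Qed.

(* Induction on [m] by [gt], then on [l] by proper encompassment, then on [r]
   by [gt]; the bound [m] is what makes [gt] and encompassment combine. *)
Lemma rule_bconv m l r : union_set R (l, r) -> encompasses m l -> rule_ok l r.
Proof.
elim: (ro_wf gt_ro m) l r => {}m _ IHm l.
elim: (wf_properly_encompasses l) => {}l _ IHl r.
elim: (ro_wf gt_ro r) => {}r _ IHr [i _ Rlr] [C [sigma em]].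
have gt_lr := run_rules_ordered Rlr.
have below u : gt l u -> gt m (fill C (subst sigma u)).
  by move=> lu; rewrite em; apply/(ro_ctx gt_ro)/(ro_subst gt_ro).
(* A term below [l], placed where [l] sits in [m], gives a term below [m]; it serves as the new
   bound for the outer induction. *)
have ok_below u v l' r' : gt l u -> ge gt u v -> union_set R (l', r') ->
    encompasses v l' -> rule_ok l' r'.
  move=> lu uv Rlr' [D [tau ev]].
  apply: (IHm (fill C (subst sigma v))) => //.
    exact/below/(gt_ge_trans gt_ro lu).
  exists (ctx_comp C (ctx_subst sigma D)), (subst sigma \o tau).
  by rewrite ev subst_fill subst_comp fill_comp.
have [pers|[j [Rj Rj1]]] := persistent_or_removed Rlr.
  apply: rt_step; split; [by right|by left|].
  by left; apply: rstep_rule.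
case: (kbl_removed_rule (run j) Rj Rj1) => /= [[u ru Rlu]|].
  (* Compose: [l] and the bound [m] stay, and the right-hand side decreases. *)
  have gt_ru := rstep_gt gt_ro (@run_rules_ordered j) ru.
  have ok_lu : rule_ok l u.
    by apply: IHr => //; [exists j.+1|exists C, sigma].
  have : bconv (ge gt r) r u.
    by apply: rstep_bconv ru => l' r'; apply: ok_below gt_lr _; right.
  move=> /bounded_conv_sym ur; apply: rt_trans ok_lu _.
  apply: bounded_conv_mono ur => v rv; left.
  exact: (gt_ge_trans gt_ro gt_lr).
move=> [u [l' [r' [Rlr' lu enc Eur]]]].
have gt_lu : gt l u.
  by apply: (rstep_gt gt_ro) lu => _ _ [-> ->]; apply: run_rules_ordered Rlr'.
(* Collapse: the bound [m] stays, since it also encompasses [l'], and the descent is in proper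
   encompassment. *)
have ok_lr' : rule_ok l' r'.
  apply: (IHl l' enc); first by exists j.
  case: enc => -[D [tau el]] _.
  exists (ctx_comp C (ctx_subst sigma D)), (subst sigma \o tau).
  by rewrite em el subst_fill subst_comp fill_comp.
have b_lu : bconv (ge gt l) l u.
  case: lu => [D [_ [_ [tau [[-> ->] el ->]]]]].
  rewrite {2}el; apply: bounded_conv_instance ok_lr' => v.
  by rewrite el; apply: ge_instance.
apply: rt_trans b_lu _.
(* Both sides of the equation left by collapse are below [l], so every rule it can meet falls under
   [ok_below]. *)
have : eqn_ok u r.
  apply: eqn_bconv; last by exists j.+1.
  by move=> v l0 r0 [uv|rv]; [apply: ok_below gt_lu uv|apply: ok_below gt_lr rv].
apply: bounded_conv_mono => v [?|?]; left.
  exact: (gt_ge_trans gt_ro gt_lu).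
exact: (gt_ge_trans gt_ro gt_lr).
Qed.

Lemma union_eqn_bconv s t : union_set E (s, t) -> eqn_ok s t.
Proof. by apply: eqn_bconv => m l r _; apply: rule_bconv. Qed.

Lemma LCP_bconv : fair gt E R ->
  forall s t u delta, LCP gt (persistent R) (s, t) ->
    gt u (subst delta s) -> gt u (subst delta t) ->
    bconv (gt u) (subst delta s) (subst delta t).
Proof.
move=> run_fair s t u delta st us ut.
have [|[v sv tv]|] := run_fair s t; first by rewrite Eomega set0U.
  apply: (joinable_bounded gt_ro persistent_rules_ordered us ut).
  by exists (subst delta v); [move: sv|move: tv];
    apply: clos_rt_map => x y; apply: rstep_subst.
(* Every intermediate term is bounded by one of the two ends, and both ends are below [u]. *)
have inst x y C sigma : union_set E (x, y) ->
    gt u (subst delta (fill C (subst sigma x))) ->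
    gt u (subst delta (fill C (subst sigma y))) ->
    bconv (gt u) (subst delta (fill C (subst sigma x)))
      (subst delta (fill C (subst sigma y))).
  move=> /union_eqn_bconv; rewrite !subst_fill !subst_comp => xy ux uy.
  apply: bounded_conv_instance xy => v [xv|yv].
    by apply: (gt_ge_trans gt_ro ux); apply: ge_instance.
  by apply: (gt_ge_trans gt_ro uy); apply: ge_instance.
case=> -[C [x [y [sigma [xy es et]]]]]; rewrite es et in us ut *.
  exact: inst.
by apply/bounded_conv_sym/inst.
Qed.

End Runs.

Theorem theorem8p17 (F : Type) (ar : F -> nat) (V : eqType)
  (V_infinite : infinite_set [set: V])
  (gt : relation (term ar V)) (gt_ro : reduction_order gt)
  (E R : nat -> set (eqn ar V))
  (run : infinite_run gt E R)
  (R0 : R 0 = set0) (E0_linear : linear_set (E 0))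
  (run_fair : fair gt E R) (Eomega : persistent E = set0) :
  complete_presentation (persistent R) (E 0).
Proof.
have ord := persistent_rules_ordered gt_ro run R0.
split; first split.
- exact: ordered_is_trs ord.
- exact: ordered_terminating ord.
- apply: (confluent_below_peaks gt_ro ord).
  by apply: (peak_bounded gt_ro V_infinite ord); apply: LCP_bconv.
- move=> s t; split; apply: conv_subset => l r.
    case/persistent_union=> i _ Rlr; apply: (run_conv run R0 (i := i)).
    by apply: conv_rule; right.
  move=> E0lr; apply: bounded_conv_conv (union_eqn_bconv gt_ro run R0 Eomega _).
  by exists 0.
Qed.
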